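(* For integers $p\ge 2$ and $d\ge 1$, let $f_0,f_1,\dots,f_{p-1}\in L^p[0,1)^d$. Then $$\int_{[0,1]^{dp}}\prod_{j=0}^{p-1}f_j\bigl(\{(-1)^j(\boldsymbol{x}_j-\boldsymbol{x}_{j+})\}\bigr)\prod_{j=0}^{p-1}\mathrm{d}\boldsymbol{x}_j =\int_{[0,1]^{dp-d}}f_0(\boldsymbol{y}_0)f_1(\boldsymbol{y}_1)\cdots f_{p-2}(\boldsymbol{y}_{p-2})\,f_{p-1}\bigl(\{\boldsymbol{y}_0-\boldsymbol{y}_1+\dots+(-1)^{p-2}\boldsymbol{y}_{p-2}\}\bigr)\prod_{j=0}^{p-2}\mathrm{d}\boldsymbol{y}_j.$$
   Context: Here $\boldsymbol{x}_0,\dots,\boldsymbol{x}_{p-1}$ and $\boldsymbol{y}_0,\dots,\boldsymbol{y}_{p-2}$ range over $[0,1]^d$; $\{\boldsymbol{z}\}=\boldsymbol{z}-\lfloor\boldsymbol{z}\rfloor$ is the componentwise fractional part; and for $j\in\{0,\dots,p-1\}$, $j+$ denotes $j+1\pmod p$.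
   Formalization: The argument of f_{p-1} on the right is {(-1)^p (y_0 - y_1 + ... + (-1)^{p-2} y_{p-2})}: unchanged for even p, but with opposite sign for odd p, where the printed identity fails (e.g. p=3, d=1, indicators of [0,1/4), [1/4,1/2), [0,1/2)). *)

(* Defs.v *)
From HB Require Import structures.
From mathcomp Require Import all_boot all_order all_algebra.
From mathcomp Require Import all_classical all_reals all_analysis.

Set Implicit Arguments.
Unset Strict Implicit.
Unset Printing Implicit Defensive.

Import Order.TTheory GRing.Theory Num.Theory.

Local Open Scope classical_set_scope.
Local Open Scope ring_scope.

Section tuple_measure.
Context d (T : measurableType d) (R : realType).
Local Open Scope ereal_scope.

Definition cons_pair n (xt : T * n.-tuple T) : n.+1.-tuple T :=
  [tuple of xt.1 :: xt.2].

Lemma measurable_cons_pair n :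
  measurable_fun [set: T * n.-tuple T] (@cons_pair n).
Proof. exact: measurable_cons measurable_fst measurable_snd. Qed.

Section cons_measure.
Variables (mu : {sigma_finite_measure set T -> \bar R}) (n : nat).
Variable nu : {sigma_finite_measure set (n.-tuple T) -> \bar R}.

Definition cons_measure : set (n.+1.-tuple T) -> \bar R :=
  pushforward (mu \x nu) (@cons_pair n).

Let cons_measure0 : cons_measure set0 = 0.
Proof. by rewrite /cons_measure /pushforward preimage_set0 measure0. Qed.

Let cons_measure_ge0 A : 0 <= cons_measure A.
Proof. by rewrite /cons_measure /pushforward; exact: measure_ge0. Qed.

Let cons_measure_sigma_additive : semi_sigma_additive cons_measure.
Proof.
exact: (@measure_semi_sigma_additive _ _ _
  (measure_function_pushforward__canonical__measure_function_Measure
    (mu \x nu) (@measurable_cons_pair n))).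
Qed.

HB.instance Definition _ := isMeasure.Build _ _ _ cons_measure
  cons_measure0 cons_measure_ge0 cons_measure_sigma_additive.

Let cons_measure_sigma_finite : sigma_finite setT cons_measure.
Proof.
have /sigma_finiteP[F [FT ndF Foo]] := sigma_finiteT mu.
have /sigma_finiteP[G [GT ndG Goo]] := sigma_finiteT nu.
pose uncons (t : n.+1.-tuple T) := (thead t, [tuple of behead t] : n.-tuple T).
have unconsK (xt : T * n.-tuple T) : uncons (cons_pair xt) = xt.
  by case: xt => x t; congr pair; apply: val_inj.
have muncons : measurable_fun [set: n.+1.-tuple T] uncons.
  apply/measurable_fun_pairP; split.
  - exact: measurable_tnth.
  - exact: measurable_behead.
exists (fun i => uncons @^-1` (F i `*` G i)).
  apply/seteqP; split => // t _.
  have [i _ Fi] : (\bigcup_i F i) (uncons t).1 by rewrite -FT.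
  have [k _ Gk] : (\bigcup_i G i) (uncons t).2 by rewrite -GT.
  exists (maxn i k) => //; split.
  - by move: Fi; exact/subsetPset/ndF/leq_maxl.
  - by move: Gk; exact/subsetPset/ndG/leq_maxr.
move=> i; have [mF Fi] := Foo i; have [mG Gi] := Goo i; split.
  rewrite -[X in measurable X]setTI; apply: muncons => //.
  exact: measurableX.
rewrite /cons_measure /pushforward (_ : _ @^-1` _ = F i `*` G i); last first.
  by rewrite -comp_preimage (_ : _ \o _ = id)//; apply/funext.
by rewrite product_measure1E// lte_mul_pinfty// ge0_fin_numE.
Qed.

HB.instance Definition _ := Measure_isSigmaFinite.Build _ _ _ cons_measure
  cons_measure_sigma_finite.

End cons_measure.

(* The n-fold product measure of mu with itself. *)
Fixpoint tuple_measure (mu : {sigma_finite_measure set T -> \bar R}) (n : nat) :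
    {sigma_finite_measure set (n.-tuple T) -> \bar R} :=
  match n with
  | 0 => \d_([tuple] : 0.-tuple T)
  | n'.+1 => cons_measure mu (tuple_measure mu n')
  end.

End tuple_measure.

Notation Rvec R d := (d.-tuple (measurableTypeR R)).

Section cubes.
Context (R : realType).
Implicit Types d n : nat.

Definition lebesgue_vec d : {sigma_finite_measure set (Rvec R d) -> \bar R} :=
  tuple_measure (@lebesgue_measure R) d.

Definition lebesgue_vecs d n :
    {sigma_finite_measure set (n.-tuple (Rvec R d)) -> \bar R} :=
  tuple_measure (@lebesgue_vec d) n.

Definition ccube d n : set (n.-tuple (Rvec R d)) :=
  [set x | forall j i, 0 <= tnth (tnth x j) i <= 1].

Definition hocube d : set (Rvec R d) := [set z | forall i, 0 <= tnth z i < 1].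

Lemma measurable_hocube d : measurable (@hocube d).
Proof.
have -> : @hocube d = \bigcap_(i in [set: 'I_d])
    ((fun z : Rvec R d => tnth z i) @^-1` [set` `[0, 1[%R]).
  apply/seteqP; split => z /= Hz.
  - by move=> i _ /=; rewrite in_itv/=; exact: Hz.
  - by move=> i; have := Hz i I; rewrite /= in_itv.
apply: fin_bigcap_measurable => //.
move=> i _; rewrite -[X in measurable X]setTI.
exact: (@measurable_tnth _ (measurableTypeR R)).
Qed.

(* Lebesgue measure on [0,1)^d, so that Lfun (lebesgue_hocube d) r is
   L^r[0,1)^d; an element of L^r[0,1)^d is represented by a Borel function
   on R^d whose values outside [0,1)^d are irrelevant. *)
Definition lebesgue_hocube d : {measure set (Rvec R d) -> \bar R} :=
  mrestr (@lebesgue_vec d) (@measurable_hocube d).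

Definition fracv d (v : 'I_d -> R) : Rvec R d :=
  [tuple v i - (Num.floor (v i))%:~R | i < d].

End cubes.

Arguments lebesgue_vec R d : clear implicits.
Arguments lebesgue_vecs R d n : clear implicits.
Arguments ccube R d n _ : clear implicits.
Arguments hocube R d _ : clear implicits.
Arguments lebesgue_hocube R d : clear implicits.

(* Main.v *)
Require Import Defs.
From mathcomp Require Import all_boot all_order all_algebra.
From mathcomp Require Import all_classical all_reals all_analysis.
From mathcomp Require Import measurable_realfun lra.
Import Order.TTheory GRing.Theory Num.Theory.
Local Open Scope ring_scope.

(** Both sides integrate one and the same function [G] on [n]-tuples of
    vectors, with [n = p - 1]: the right-hand side integrates [G] itself, the
    left-hand side integrates [G] composed with the map sending
    [(x_0, ..., x_n)] to the tuple of the [n] points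
    [y_j = {(-1)^j (x_j - x_(j+1))}].  The last factor of the left-hand
    integrand is of that form because, modulo 1,
    [sum_j (-1)^j y_j = sum_j (x_j - x_(j+1)) = x_0 - x_n]: the edges of a
    cycle add up to zero, so the last one is determined by the others
    ([closing_map_chain]).

    It remains to see that this map carries Lebesgue measure on the unit cube
    to Lebesgue measure on the smaller unit cube.  For [x_1, ..., x_n] fixed,
    [y_0] is the image of [x_0] under an isometry of the torus, which
    preserves Lebesgue measure, and [x_0] occurs in none of the other [y_j].
    By Tonelli's theorem [x_0] can thus be replaced by an independent uniform
    variable; then [x_1] can, and so on, until only [x_n] is left, which is
    integrated out against total mass 1 ([integral_map_chain]).

    The invariance on the torus reduces, again by Tonelli's theorem, to one
    coordinate ([integral_invariant_map_coord]); there it says that a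
    1-periodic function has the same integral over any two intervals of
    length 1 ([ge0_integral_period]).

    All of this is done for nonnegative measurable functions, for which
    Tonelli's theorem needs no integrability; the theorem follows by applying
    it to the positive and the negative part of [G]. *)

(** * Isometries of the circle *)

Section unit_circle.
Context {R : realType}.
Implicit Types (a b c x : R) (h g : R -> \bar R).
Local Open Scope classical_set_scope.
Local Open Scope ereal_scope.
Local Notation mu := (@lebesgue_measure R).

Definition isom1 (s : bool) a x : R := ((-1) ^+ s * (x - a))%R.

Lemma measurable_isom1 s a :
  measurable_fun [set: measurableTypeR R] (isom1 s a : _ -> measurableTypeR R).
Proof.
apply: measurable_funM; first exact: measurable_cst.
by apply: measurable_funB; [exact: measurable_id|exact: measurable_cst].
Qed.

(** By uniqueness of Lebesgue measure, it suffices to compare lengths of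
    intervals. *)
Lemma lebesgue_measure_isom1 s a (A : set R) : measurable A ->
  pushforward mu (isom1 s a : measurableTypeR R -> measurableTypeR R) A = mu A.
Proof.
move=> mA; apply/esym.
pose nu := (measure_function_pushforward__canonical__measure_function_Measure
    mu (measurable_isom1 s a)).
apply: (@lebesgue_measure_unique _ nu) => // _ [[u v]] _ <-.
rewrite /nu/= /pushforward.
have -> : isom1 s a @^-1` `]u, v]%classic =
    if s then `[(a - v)%R, (a - u)%R[%classic
    else `](u + a)%R, (v + a)%R]%classic.
  by rewrite /isom1; case: s {nu}; apply/seteqP; split=> x /=; rewrite !in_itv/=;
    rewrite ?expr0 ?expr1 => /andP[h1 h2]; apply/andP; split; lra.
case: s {nu}; rewrite !lebesgue_measure_itv/= !lte_fin.
  by rewrite ltrD2l ltrN2 -EFinD -EFinD; case: ifPn => // _; congr EFin; lra.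
by rewrite ltrD2r -EFinD -EFinD; case: ifPn => // _; congr EFin; lra.
Qed.

Lemma ge0_integral_isom1 s a h (D : set R) : measurable D ->
  measurable_fun [set: R] h -> (forall x, 0 <= h x) ->
  \int[mu]_(x in isom1 s a @^-1` D) h (isom1 s a x) = \int[mu]_(x in D) h x.
Proof.
move=> mD mh h0.
rewrite -(@ge0_integral_pushforward _ _ _ _ _ _ (measurable_isom1 s a) mu D h)//.
- apply: eq_measure_integral => [|mphi A mA _]; first exact: measurable_isom1.
  exact: lebesgue_measure_isom1.
- exact: measurable_funTS.
Qed.

(** With [n = Num.floor c], the part of the interval beyond [n + 1] is
    translated back by 1 to sit just below [c].  The two parts then fill
    [`[n, n + 1[], an integer translate of [`[0, 1[]. *)
Lemma ge0_integral_period h c :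
  measurable_fun [set: R] h -> (forall x, 0 <= h x) ->
  (forall x (n : int), h (x + n%:~R)%R = h x) ->
  \int[mu]_(x in `[c, (c + 1)%R[) h x = \int[mu]_(x in `[0%R, 1%R[) h x.
Proof.
move=> mh h0 hp.
have shift (u v : R) (n : int) :
    \int[mu]_(x in `[(u + n%:~R)%R, (v + n%:~R)%R[) h x =
    \int[mu]_(x in `[u, v[) h x.
  rewrite -(@ge0_integral_isom1 false (- n%:~R)%R)//.
  have -> : isom1 false (- n%:~R)%R @^-1` `[(u + n%:~R)%R, (v + n%:~R)%R[ =
      `[u, v[%classic.
    by apply/seteqP; split=> x /=; rewrite /isom1 !in_itv/= expr0 => /andP[? ?];
      apply/andP; split; lra.
  by apply: eq_integral => x _; rewrite /isom1 expr0 mul1r opprK hp.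
have split_at (u v w : R) : (u <= v)%R -> (v <= w)%R ->
    \int[mu]_(x in `[u, w[) h x =
    \int[mu]_(x in `[u, v[) h x + \int[mu]_(x in `[v, w[) h x.
  move=> uv vw; rewrite -ge0_integral_setU//=.
  - by rewrite -itv_bndbnd_setU.
  - exact: measurable_funTS.
  - apply/disj_setPS => x /= []; rewrite !in_itv/= => /andP[_ xv] /andP[vx _].
    by move: (lt_le_trans xv vx); rewrite ltxx.
pose n := Num.floor c.
have nc : (n%:~R <= c)%R by exact: floor_le.
have cn : (c < n%:~R + 1)%R.
  by have := floorD1_gt c; rewrite intrD.
rewrite (@split_at c (n%:~R + 1)%R (c + 1)%R); [|exact: ltW|lra].
have := shift n%:~R c 1%Z; rewrite mulr1z => ->.
rewrite addeC -split_at//; last exact: ltW.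
by have := shift 0%R 1%R n; rewrite add0r [(1 + _)%R]addrC.
Qed.

Definition fracr x : R := (x - (Num.floor x)%:~R)%R.

Lemma measurable_fracr :
  measurable_fun [set: measurableTypeR R] (fracr : _ -> measurableTypeR R).
Proof.
apply: measurable_funB; first exact: measurable_id.
apply: nondecreasing_measurable => //= x y xy.
by rewrite ler_int; exact: le_floor.
Qed.

Lemma fracrDz x (n : int) : fracr (x + n%:~R)%R = fracr x.
Proof.
by rewrite /fracr floorDrz ?intr_int// intrKfloor intrD opprD addrACA subrr addr0.
Qed.

Lemma fracr_id x : (0 <= x < 1)%R -> fracr x = x.
Proof. by move=> x01; rewrite /fracr (@floor_def _ _ 0)// subr0. Qed.

(** The isometry maps the unit interval onto an interval of length 1, on which
    the 1-periodic function [g \o fracr] has the same integral as on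
    [`[0, 1[].  Replacing closed by half-open intervals only discards null
    sets. *)
Lemma ge0_integral_fracr_isom1 s a g :
  measurable_fun [set: R] g -> (forall x, 0 <= g x) ->
  \int[mu]_(x in `[0%R, 1%R]) g (fracr (isom1 s a x)) =
  \int[mu]_(x in `[0%R, 1%R]) g x.
Proof.
move=> mg g0.
have mh : measurable_fun [set: R] (g \o fracr).
  exact: measurableT_comp mg measurable_fracr.
have mhi : measurable_fun [set: R] (fun x => g (fracr (isom1 s a x))).
  exact: measurableT_comp mh (measurable_isom1 s a).
have h0 x : 0 <= (g \o fracr) x by exact: g0.
have hp x (n : int) : (g \o fracr) (x + n%:~R)%R = (g \o fracr) x.
  by rewrite /= fracrDz.
have -> : \int[mu]_(x in `[0%R, 1%R]) g x =
    \int[mu]_(x in `[0%R, 1%R[) (g \o fracr) x.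
  rewrite -integral_itv_bndo_bndc; last exact: measurable_funTS.
  by apply: eq_integral => x; rewrite inE/= in_itv/= => x01; rewrite fracr_id.
case: s mhi => mhi.
  (* A reflection swaps the two endpoints, so here the half-open interval has
     to be the one closed on the right. *)
  rewrite -integral_itv_obnd_cbnd; last exact: measurable_funTS.
  rewrite -(@ge0_integral_period _ (a - 1)%R)//.
  rewrite -[RHS](@ge0_integral_isom1 true a)//.
  congr (integral mu _ _).
  by apply/seteqP; split=> x /=; rewrite /isom1 !in_itv/= expr1 => /andP[? ?];
      apply/andP; split; lra.
rewrite -integral_itv_bndo_bndc; last exact: measurable_funTS.
rewrite -(@ge0_integral_period _ (- a)%R)//.
rewrite -[RHS](@ge0_integral_isom1 false a)//.
congr (integral mu _ _).
by apply/seteqP; split=> x /=; rewrite /isom1 !in_itv/= expr0 => /andP[? ?];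
    apply/andP; split; lra.
Qed.

End unit_circle.
(** * Tonelli's theorem on product cubes *)

Section tonelli_rectangle.
Set Implicit Arguments.
Unset Strict Implicit.
Context d1 d2 (T1 : measurableType d1) (T2 : measurableType d2) (R : realType).
Variables (m1 : {sigma_finite_measure set T1 -> \bar R}).
Variables (m2 : {sigma_finite_measure set T2 -> \bar R}).
Variables (A : set T1) (B : set T2) (f : T1 * T2 -> \bar R).
Local Open Scope classical_set_scope.
Local Open Scope ereal_scope.
Hypotheses (mA : measurable A) (mB : measurable B).
Hypotheses (mf : measurable_fun [set: T1 * T2] f) (f0 : forall z, 0 <= f z).

Let patch_rectangle x y :
  (f \_ (A `*` B)) (x, y) = ((fun x => ((fun y => f (x, y)) \_ B) y) \_ A) x.
Proof.
by rewrite /patch in_setX/=; case: (x \in A); case: (y \in B).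
Qed.

Let mfAB : measurable_fun [set: T1 * T2] (f \_ (A `*` B)).
Proof.
apply/(measurable_restrictT _ _).1; first exact: measurableX.
exact: measurable_funTS.
Qed.

Let fAB0 z : 0 <= (f \_ (A `*` B)) z.
Proof. by apply: erestrict_ge0 => *; exact: f0. Qed.

Lemma ge0_integral_rectangle1 :
  \int[m1 \x m2]_(z in A `*` B) f z =
  \int[m1]_(x in A) \int[m2]_(y in B) f (x, y).
Proof.
rewrite integral_mkcond fubini_tonelli1// [RHS]integral_mkcond.
apply: eq_integral => x _; rewrite /fubini_F.
under eq_integral do rewrite patch_rectangle.
rewrite {3}/patch; case: ifPn => xA; first by rewrite [RHS]integral_mkcond;
  apply: eq_integral => y _; rewrite {1}/patch xA.
by under eq_integral do rewrite {1}/patch (negbTE xA); rewrite integral0.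
Qed.

Lemma ge0_integral_rectangle2 :
  \int[m1 \x m2]_(z in A `*` B) f z =
  \int[m2]_(y in B) \int[m1]_(x in A) f (x, y).
Proof.
rewrite integral_mkcond fubini_tonelli2// [RHS]integral_mkcond.
apply: eq_integral => y _; rewrite /fubini_G.
under eq_integral do rewrite patch_rectangle.
rewrite -integral_mkcond {2}/patch; case: ifPn => yB.
  by apply: eq_integral => x _; rewrite {1}/patch yB.
by under eq_integral do rewrite {1}/patch (negbTE yB); rewrite integral0.
Qed.

End tonelli_rectangle.

Section tuple_cube.
Set Implicit Arguments.
Unset Strict Implicit.
Context d (T : measurableType d) (R : realType).
Variables (mu : {sigma_finite_measure set T -> \bar R}) (D : set T).
Local Open Scope classical_set_scope.
Local Open Scope ereal_scope.
Hypothesis mD : measurable D.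

Definition cube n : set (n.-tuple T) := [set t | forall j, D (tnth t j)].

Lemma measurable_cube n : measurable (@cube n).
Proof.
have -> : @cube n = \bigcap_(i in [set: 'I_n]) ((fun z => tnth z i) @^-1` D).
  by apply/seteqP; split => z Hz; [move=> i _|move=> i]; apply: Hz.
apply: fin_bigcap_measurable => // i _.
rewrite -[X in measurable X]setTI; exact: measurable_tnth.
Qed.

Lemma preimage_cube n : @cons_pair _ T n @^-1` @cube n.+1 = D `*` @cube n.
Proof.
apply/seteqP; split => [[x t]/= H|[x t]/= [Dx Dt] j].
  split; first by have := H ord0.
  by move=> j; have := H (lift ord0 j); rewrite tnthS.
by case: (unliftP ord0 j) => [k|] ->; rewrite ?tnthS//; exact: Dt.
Qed.

Lemma ge0_integral_cube_cons n (F : n.+1.-tuple T -> \bar R) :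
  measurable_fun [set: n.+1.-tuple T] F -> (forall t, 0 <= F t) ->
  \int[tuple_measure mu n.+1]_(t in @cube n.+1) F t =
  \int[mu \x tuple_measure mu n]_(z in D `*` @cube n) F (cons_pair z).
Proof.
move=> mF F0; rewrite -preimage_cube.
rewrite -(@ge0_integral_pushforward _ _ _ _ _ _ (@measurable_cons_pair _ T n))//.
- exact: measurable_cube.
- exact: measurable_funTS.
Qed.

Lemma ge0_integral_cube_cons1 n (F : n.+1.-tuple T -> \bar R) :
  measurable_fun [set: n.+1.-tuple T] F -> (forall t, 0 <= F t) ->
  \int[tuple_measure mu n.+1]_(t in @cube n.+1) F t =
  \int[mu]_(x in D) \int[tuple_measure mu n]_(t in @cube n) F (cons_pair (x, t)).
Proof.
move=> mF F0; rewrite ge0_integral_cube_cons// ge0_integral_rectangle1//.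
- exact: measurable_cube.
- exact: measurableT_comp mF (@measurable_cons_pair _ T n).
Qed.

Lemma ge0_integral_cube_cons2 n (F : n.+1.-tuple T -> \bar R) :
  measurable_fun [set: n.+1.-tuple T] F -> (forall t, 0 <= F t) ->
  \int[tuple_measure mu n.+1]_(t in @cube n.+1) F t =
  \int[tuple_measure mu n]_(t in @cube n) \int[mu]_(x in D) F (cons_pair (x, t)).
Proof.
move=> mF F0; rewrite ge0_integral_cube_cons// ge0_integral_rectangle2//.
- exact: measurable_cube.
- exact: measurableT_comp mF (@measurable_cons_pair _ T n).
Qed.

Lemma tuple_measure_cube n : mu D = 1 -> tuple_measure mu n (@cube n) = 1.
Proof.
move=> muD; elim: n => [|n IHn].
  by rewrite /= diracE mem_set// => -[].
transitivity (mu D * tuple_measure mu n (@cube n)).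
  rewrite [LHS]/= /cons_measure /pushforward preimage_cube product_measure1E//.
  exact: measurable_cube.
by rewrite muD IHn mule1.
Qed.

End tuple_cube.

(** * Maps of tuples that preserve integrals *)

Section invariant_maps.
Set Implicit Arguments.
Unset Strict Implicit.
Context d (T : measurableType d) (R : realType).
Local Open Scope classical_set_scope.
Local Open Scope ereal_scope.

(** [phi] preserves the restriction of [mu] to [D].  In terms of integrals, the
    property composes directly with Tonelli's theorem. *)
Definition integral_invariant (mu : {measure set T -> \bar R}) (D : set T)
    (phi : T -> T) := forall g : T -> \bar R,
  measurable_fun [set: T] g -> (forall x, 0 <= g x) ->
  \int[mu]_(x in D) g (phi x) = \int[mu]_(x in D) g x.

Variables (mu : {sigma_finite_measure set T -> \bar R}) (D : set T).
Hypothesis mD : measurable D.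

Definition map_coord n (phi : 'I_n -> T -> T) (t : n.-tuple T) : n.-tuple T :=
  [tuple phi i (tnth t i) | i < n].

Lemma measurable_map_coord n (phi : 'I_n -> T -> T) :
  (forall i, measurable_fun [set: T] (phi i)) ->
  measurable_fun [set: n.-tuple T] (map_coord phi).
Proof.
move=> mphi; apply/measurable_fun_tnthP => i.
have -> : (fun t : n.-tuple T => tnth t i) \o map_coord phi =
    phi i \o (fun t => tnth t i) by apply/funext => t /=; rewrite tnth_mktuple.
by apply: measurableT_comp => //; exact: measurable_tnth.
Qed.

Lemma map_coord_cons n (phi : 'I_n.+1 -> T -> T) (x : T) (t : n.-tuple T) :
  map_coord phi (cons_pair (x, t)) =
  cons_pair (phi ord0 x, map_coord (fun i => phi (lift ord0 i)) t).
Proof.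
apply: eq_from_tnth => i; rewrite tnth_mktuple.
by case: (unliftP ord0 i) => [k|] ->; rewrite ?tnthS ?tnth_mktuple.
Qed.

(** A product of maps preserving a measure preserves the product measure: the
    coordinates are treated one at a time. *)
Lemma integral_invariant_map_coord n (phi : 'I_n -> T -> T) :
  (forall i, measurable_fun [set: T] (phi i)) ->
  (forall i, integral_invariant mu D (phi i)) ->
  forall G : n.-tuple T -> \bar R,
  measurable_fun [set: n.-tuple T] G -> (forall t, 0 <= G t) ->
  \int[tuple_measure mu n]_(t in @cube _ T D n) G (map_coord phi t) =
  \int[tuple_measure mu n]_(t in @cube _ T D n) G t.
Proof.
elim: n phi => [|n IHn] phi mphi iphi G mG G0.
  by apply: eq_integral => t _; congr G; rewrite [LHS]tuple0 [RHS]tuple0.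
have mphi' := measurable_map_coord (fun i => mphi (lift ord0 i)).
rewrite ge0_integral_cube_cons1//; last first.
  by apply: measurableT_comp mG _; exact: measurable_map_coord.
under eq_integral => x _.
  under eq_integral do rewrite map_coord_cons.
  rewrite (IHn (fun i => phi (lift ord0 i)) _ _
    (fun t => G (cons_pair (phi ord0 x, t))))//; last first.
    apply: measurableT_comp mG _.
    by apply: measurable_cons; first [exact: measurable_cst|exact: measurable_id].
  over.
pose K (z : T * n.-tuple T) := G (cons_pair (phi ord0 z.1, z.2)).
have K0 z : 0 <= K z by exact: G0.
have mK : measurable_fun setT K.
  apply: measurableT_comp mG _.
  apply: measurable_cons; last exact: measurable_snd.
  exact: measurableT_comp (mphi ord0) measurable_fst.
rewrite -(@ge0_integral_rectangle1 _ _ _ _ _ _ _ _ _ K)//; last exact: measurable_cube.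
rewrite ge0_integral_rectangle2//; last exact: measurable_cube.
rewrite ge0_integral_cube_cons2//; apply: eq_integral => t _.
rewrite /K/= (iphi ord0 (fun x => G (cons_pair (x, t))))//.
apply: measurableT_comp mG _.
by apply: measurable_cons; first [exact: measurable_cst|exact: measurable_id].
Qed.

(** The image of [t] has one component per pair of consecutive components of
    [t]. *)
Definition map_chain (psi : nat -> T -> T -> T) n (t : n.+1.-tuple T) : n.-tuple T :=
  [tuple psi j (tnth t (widen_ord (leqnSn n) j)) (tnth t (lift ord0 j)) | j < n].

Lemma measurable_map_chain psi n :
  (forall j, measurable_fun [set: T * T] (fun z => psi j z.1 z.2)) ->
  measurable_fun [set: n.+1.-tuple T] (@map_chain psi n).
Proof.
move=> mpsi; apply/measurable_fun_tnthP => j.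
have -> : (fun t : n.-tuple T => tnth t j) \o @map_chain psi n =
    (fun z => psi j z.1 z.2) \o
      (fun t : n.+1.-tuple T =>
        (tnth t (widen_ord (leqnSn n) j), tnth t (lift ord0 j))).
  by apply/funext => t /=; rewrite tnth_mktuple.
apply: measurableT_comp => //; apply/measurable_fun_pairP.
by split; exact: measurable_tnth.
Qed.

Lemma map_chain_cons psi n (x : T) (t : n.+1.-tuple T) :
  map_chain psi (cons_pair (x, t)) =
  cons_pair (psi 0%N x (thead t), map_chain (fun j => psi j.+1) t).
Proof.
apply: eq_from_tnth => j; rewrite tnth_mktuple.
case: (unliftP ord0 j) => [k|] ->.
  rewrite !tnthS tnth_mktuple /=.
  congr psi; rewrite -(tnthS x t); congr tnth.
  exact: val_inj.
by congr psi; rewrite tnthS.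
Qed.

(** The first component [x] of the argument enters only the first component
    [psi 0 x (thead t)] of the image.  Integrating over [x] first, invariance
    of [psi 0 ^~ (thead t)] replaces it by [x] itself, which decouples it from
    the shorter tuple [t], to which induction applies.  At the end one
    component is left over, and its integral contributes the factor
    [mu D = 1]. *)
Lemma integral_map_chain psi n : mu D = 1 ->
  (forall j, measurable_fun [set: T * T] (fun z => psi j z.1 z.2)) ->
  (forall j b, integral_invariant mu D (psi j ^~ b)) ->
  forall G : n.-tuple T -> \bar R,
  measurable_fun [set: n.-tuple T] G -> (forall t, 0 <= G t) ->
  \int[tuple_measure mu n.+1]_(t in @cube _ T D n.+1) G (map_chain psi t) =
  \int[tuple_measure mu n]_(t in @cube _ T D n) G t.
Proof.
move=> muD; elim: n psi => [|n IHn] psi mpsi ipsi G mG G0.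
  have tuple0E (u v : 0.-tuple T) : u = v by rewrite [u]tuple0 [v]tuple0.
  rewrite ge0_integral_cube_cons1//; last first.
    by apply: measurableT_comp mG _; exact: measurable_map_chain.
  under eq_integral => x _.
    under eq_integral => t _ do rewrite (tuple0E (map_chain _ _) t).
    over.
  pose c := \int[tuple_measure mu 0]_(t in @cube _ T D 0) G t.
  transitivity (c * mu D); last by rewrite muD mule1.
  exact: (@integral_cst _ _ _ mu D mD c).
have mPsi' := @measurable_map_chain (fun j => psi j.+1) n (fun j => mpsi j.+1).
rewrite ge0_integral_cube_cons2//; last first.
  by apply: measurableT_comp mG _; exact: measurable_map_chain.
under eq_integral => t _.
  under eq_integral do rewrite map_chain_cons.
  rewrite (ipsi 0%N (thead t)
    (fun y => G (cons_pair (y, map_chain (fun j => psi j.+1) t))))//; last first.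
    apply: measurableT_comp mG _.
    by apply: measurable_cons; first [exact: measurable_cst|exact: measurable_id].
  over.
pose K (z : T * n.+1.-tuple T) :=
  G (cons_pair (z.1, map_chain (fun j => psi j.+1) z.2)).
have K0 z : 0 <= K z by exact: G0.
have mK : measurable_fun setT K.
  apply: measurableT_comp mG _.
  apply: measurable_cons; first exact: measurable_fst.
  exact: measurableT_comp mPsi' measurable_snd.
rewrite -(@ge0_integral_rectangle2 _ _ _ _ _ _ _ _ _ K)//; last exact: measurable_cube.
rewrite ge0_integral_rectangle1//; last exact: measurable_cube.
rewrite ge0_integral_cube_cons1//; apply: eq_integral => x _.
rewrite /K/= (IHn (fun j => psi j.+1) _ _ (fun t => G (cons_pair (x, t))))//.
apply: measurableT_comp mG _.
by apply: measurable_cons; first [exact: measurable_cst|exact: measurable_id].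
Qed.

End invariant_maps.

(** * The edges of a cycle on the torus *)

Section vector_circle.
Set Implicit Arguments.
Unset Strict Implicit.
Context {R : realType}.
Local Open Scope classical_set_scope.
Local Open Scope ereal_scope.

Definition unit_cube d : set (Rvec R d) :=
  @cube _ (measurableTypeR R) `[0%R, 1%R] d.

Lemma measurable_unit_cube d : measurable (@unit_cube d).
Proof. by apply: measurable_cube; exact: measurable_itv. Qed.

Lemma lebesgue_vec_unit_cube d : lebesgue_vec R d (@unit_cube d) = 1.
Proof.
apply: tuple_measure_cube => //.
by rewrite [LHS]lebesgue_measure_itv/= lte_fin ltr01 -EFinB subr0.
Qed.

Lemma ccubeE d n : ccube R d n = @cube _ (Rvec R d) (@unit_cube d) n.
Proof.
by apply/seteqP; split=> x H j i; have := H j i; rewrite /= in_itv.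
Qed.

(** [edge j (tnth x j) (tnth x (ordS j))] is the argument of [f j] in the
    integral over the cycle. *)
Definition edge d (j : nat) (x b : Rvec R d) : Rvec R d :=
  fracv (fun i => (-1) ^+ j * (tnth x i - tnth b i))%R.

Lemma measurable_edge d j :
  measurable_fun [set: Rvec R d * Rvec R d] (fun z => edge j z.1 z.2).
Proof.
apply/measurable_fun_tnthP => i.
have -> : (fun t : Rvec R d => tnth t i) \o (fun z => edge j z.1 z.2) =
    fracr \o (fun z => (-1) ^+ j * (tnth z.1 i - tnth z.2 i))%R.
  by apply/funext => z /=; rewrite tnth_mktuple.
apply: measurableT_comp; first exact: measurable_fracr.
apply: measurable_funM; first exact: measurable_cst.
by apply: measurable_funB; apply: (measurableT_comp (measurable_tnth i)).
Qed.

Lemma integral_invariant_edge d j (b : Rvec R d) :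
  integral_invariant (lebesgue_vec R d) (@unit_cube d) (@edge d j ^~ b).
Proof.
have edgeE x : edge j x b =
    map_coord (fun i => fracr \o isom1 (odd j) (tnth b i)) x.
  by apply: eq_from_tnth => i; rewrite !tnth_mktuple /= /isom1 signr_odd.
move=> g mg g0; under eq_integral do rewrite edgeE.
apply: integral_invariant_map_coord => //.
- by move=> i; apply: measurableT_comp measurable_fracr (measurable_isom1 _ _).
- by move=> i h mh h0; exact: ge0_integral_fracr_isom1.
Qed.

(** The argument of the last function in the integral over [n = p - 1]
    vectors, as a function of these vectors. *)
Definition closing d n (y : n.-tuple (Rvec R d)) : Rvec R d :=
  fracv (fun i => (-1) ^+ n.+1 * (\sum_(j < n) (-1) ^+ j * tnth (tnth y j) i))%R.

Lemma measurable_closing d n :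
  measurable_fun [set: n.-tuple (Rvec R d)] (@closing d n).
Proof.
apply/measurable_fun_tnthP => i.
have -> : (fun t : Rvec R d => tnth t i) \o @closing d n = fracr \o
    (fun y => (-1) ^+ n.+1 * (\sum_(j < n) (-1) ^+ j * tnth (tnth y j) i))%R.
  by apply/funext => y /=; rewrite tnth_mktuple.
apply: measurableT_comp; first exact: measurable_fracr.
apply: measurable_funM; first exact: measurable_cst.
apply: measurable_sum => j; apply: measurable_funM; first exact: measurable_cst.
by apply: (measurableT_comp (measurable_tnth i)); exact: measurable_tnth.
Qed.

(** The signed edges telescope modulo 1, so those along the path from [x_0] to
    [x_n] determine the edge that closes the cycle. *)
Lemma closing_map_chain d n (x : n.+1.-tuple (Rvec R d)) :
  closing (map_chain (@edge d) x) = edge n (tnth x ord_max) (tnth x ord0).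
Proof.
apply: eq_from_tnth => i; rewrite !tnth_mktuple -!/(fracr _).
pose c k := tnth (tnth x (inord k)) i.
pose u j := ((-1) ^+ j * (c j - c j.+1))%R.
(* [m] collects the integer parts dropped by the fractional parts of the
   edges. *)
pose m := ((-1) ^+ n * \sum_(j < n) (-1) ^+ j * Num.floor (u j) : int)%R.
rewrite -[RHS](fracrDz _ m); congr fracr.
have -> : tnth (tnth x ord_max) i = c n.
  by congr (tnth (tnth x _) i); apply: val_inj; rewrite /= inordK.
have -> : tnth (tnth x ord0) i = c 0%N.
  by congr (tnth (tnth x _) i); apply: val_inj; rewrite /= inordK.
have -> : (c n - c 0%N = - \sum_(j < n) (c j - c j.+1))%R.
  rewrite -(big_mkord xpredT (fun j => c j - c j.+1)%R) -sumrN.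
  by rewrite -(telescope_sumr c (leq0n n)); apply: eq_bigr => j _; rewrite opprB.
rewrite rmorphM rmorph_sum rmorphXn rmorphN1 /= -mulrDr exprS mulN1r mulNr -mulrN.
congr (_ * _)%R; rewrite -sumrN -sumrN -big_split/=; apply: eq_bigr => j _.
rewrite !tnth_mktuple.
have -> : tnth (tnth x (widen_ord (leqnSn n) j)) i = c j.
  by congr (tnth (tnth x _) i); apply: val_inj; rewrite /= inordK// ltnS ltnW.
have -> : tnth (tnth x (lift ord0 j)) i = c j.+1.
  by congr (tnth (tnth x _) i); apply: val_inj; rewrite /= inordK// ltnS.
rewrite -/(u j) mulrBr opprB addrC rmorphM rmorphXn rmorphN1 /=; congr (_ + _)%R.
by rewrite /u mulrA -expr2 sqrr_sign mul1r.
Qed.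

End vector_circle.

(* The factor (-1) ^+ p below is 1 for even p; for odd p it is the sign that
   (-1)^(p-1) (x_(p-1) - x_0) forces on the alternating sum of the
   y_j = (-1)^j (x_j - x_(j+1)), and the identity fails without it. *)
Theorem lemma6 (R : realType) (p d : nat) (hp : (2 <= p)%N) (hd : (1 <= d)%N)
    (f : nat -> Rvec R d -> R)
    (hf : forall j : nat, (j < p)%N ->
      f j \in Lfun (lebesgue_hocube R d) (p%:R)%:E) :
  (\int[lebesgue_vecs R d p]_(x in ccube R d p)
     (\prod_(j < p)
        f j (fracv (fun i : 'I_d =>
          (-1) ^+ j * (tnth (tnth x j) i - tnth (tnth x (ordS j)) i)))%R)%:E
  = \int[lebesgue_vecs R d p.-1]_(y in ccube R d p.-1)
     ((\prod_(j < p.-1) f j (tnth y j)) *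
        f p.-1 (fracv (fun i : 'I_d =>
          (-1) ^+ p * (\sum_(j < p.-1) (-1) ^+ j * tnth (tnth y j) i))))%R%:E)%E.
Proof.
case: p hp hf => [//|n _ hf].
have mf j : (j < n.+1)%N -> measurable_fun setT (f j).
  by move=> jn; exact: (set_mem (sub_Lfun_mfun (hf j jn))).
pose G (y : n.-tuple (Rvec R d)) : \bar R :=
  ((\prod_(j < n) f j (tnth y j)) * f n (closing y))%R%:E.
have mG : measurable_fun setT G.
  apply/measurable_EFinP; apply: measurable_funM.
    apply: measurable_prod => j _.
    apply: measurableT_comp (measurable_tnth j).
    by apply: mf; rewrite ltnS ltnW.
  by apply: measurableT_comp (mf n _) _ => //; exact: measurable_closing.
have GE (x : n.+1.-tuple (Rvec R d)) :
    (\prod_(j < n.+1) f j (edge j (tnth x j) (tnth x (ordS j))))%R%:E =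
    G (map_chain (@edge R d) x).
  congr EFin; rewrite big_ord_recr/= closing_map_chain; congr (_ * _).
    apply: eq_bigr => j _; rewrite tnth_mktuple; congr (f _ (edge _ _ (tnth x _))).
    by apply: val_inj; rewrite /= modn_small// ltnS.
  by congr (f _ (edge _ _ (tnth x _))); apply: val_inj; rewrite /= modnn.
rewrite !ccubeE; under eq_integral do rewrite GE.
have chainE (H : n.-tuple (Rvec R d) -> \bar R) :
    measurable_fun setT H -> (forall y, (0 <= H y)%E) ->
    (\int[lebesgue_vecs R d n.+1]_(x in @cube _ (Rvec R d) (@unit_cube R d) n.+1)
      H (map_chain (@edge R d) x) =
    \int[lebesgue_vecs R d n]_(y in @cube _ (Rvec R d) (@unit_cube R d) n) H y)%E.
  apply: integral_map_chain.
  - exact: measurable_unit_cube.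
  - exact: lebesgue_vec_unit_cube.
  - exact: measurable_edge.
  - exact: integral_invariant_edge.
rewrite integralE [RHS]integralE; congr (_ - _)%E.
- transitivity (\int[lebesgue_vecs R d n.+1]_(x in @cube _ _ (@unit_cube R d) n.+1)
      (G^\+ (map_chain (@edge R d) x)))%E.
    by apply: eq_integral => x _; rewrite !funeposE.
  by apply: (chainE (G^\+)%E) => //; exact: measurable_funepos.
- transitivity (\int[lebesgue_vecs R d n.+1]_(x in @cube _ _ (@unit_cube R d) n.+1)
      (G^\- (map_chain (@edge R d) x)))%E.
    by apply: eq_integral => x _; rewrite !funenegE.
  by apply: (chainE (G^\-)%E) => //; exact: measurable_funeneg.
Qed.
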